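(* Let $p\in(0,1)$ and let $(\mathbb{Y},\mathbb{R},\nu)$ be the dynamical system of the random Fibonacci tilings, where $\mathbb{Y}=\mathbb{Y}_\zeta$ is the geometric hull and $\nu=\nu_{\mathsf{pf}}$ the patch frequency measure. The topological point spectrum of $(\mathbb{Y},\mathbb{R},\nu)$ is trivial: the only continuous eigenfunction (up to a multiplicative constant) is the constant one, with eigenvalue $k=0$.
   Context: Notation: $\tau=(1+\sqrt5)/2$, $q=1-p$. Random Fibonacci substitution: on the alphabet $\{a,b\}$, $\zeta$ maps $a\mapsto ba$ with probability $p$ and $a\mapsto ab$ with probability $q$, and $b\mapsto a$; it is applied independently to every letter of a word and independently in each iteration step. A finite word is legal if it is a subword of some realisation of $\zeta^k(a)$ for some $k\in\mathbb{N}$. $\mathbb{X}_\zeta\subset\{a,b\}^{\mathbb{Z}}$ is the set of bi-infinite sequences all of whose finite subwords are legal. Geometric hull: replace $a$ by an interval (tile) of length $\tau$ and $b$ by an interval of length $1$, with the left endpoint of the tile at position $0$ of the sequence placed at $0\in\mathbb{R}$. $\mathbb{Y}_\zeta$ is the set of all translates $t+\mathcal{T}$, $t\in\mathbb{R}$, of the tilings so obtained from elements of $\mathbb{X}_\zeta$, with the local topology (two tilings are close if they agree on a large interval around $0$ after a small translation); $\mathbb{R}$ acts by translation. Patch frequency measure: $\nu_{\mathsf{pf}}$ is the translation-invariant, ergodic probability measure on $\mathbb{Y}_\zeta$ obtained, as the normalised suspension measure, from the shift-invariant probability measure on $\mathbb{X}_\zeta$ giving the cylinder set of each legal word $w$ the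 mass $\lim_{n\to\infty}\mathbb{E}(\text{number of occurrences of }w\text{ in }\zeta^n(a))/\mathbb{E}(\text{length of }\zeta^n(a))$. Eigenfunctions: $0\ne f\in L^2(\mathbb{Y},\nu)$ is an eigenfunction if there is $k\in\mathbb{R}$ with $f(t+y)=e^{2\pi i kt}f(y)$ for all $t\in\mathbb{R}$ and $\nu$-a.e. $y\in\mathbb{Y}$. It is continuous if it is represented by a continuous function on $\mathbb{Y}$ for which this relation holds for all $y\in\mathbb{Y}$; then $k$ is called a topological eigenvalue. *)

(* Defs.v *)
From HB Require Import structures.
From mathcomp Require Import all_boot all_order all_algebra.
From mathcomp Require Import all_classical all_reals all_analysis.
From mathcomp Require Import complex.
From mathcomp Require Import zify ring lra.

Set Implicit Arguments.
Unset Strict Implicit.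
Unset Printing Implicit Defensive.

Import Order.TTheory GRing.Theory Num.Theory.
Import numFieldNormedType.Exports.

Local Open Scope classical_set_scope.
Local Open Scope ring_scope.

Inductive letter := la | lb.

Definition is_la (l : letter) : bool := if l is la then true else false.
Definition letter_of_bool (c : bool) : letter := if c then la else lb.
Lemma is_laK : cancel is_la letter_of_bool. Proof. by case. Qed.
HB.instance Definition _ := Equality.copy letter (can_type is_laK).
HB.instance Definition _ := Choice.copy letter (can_type is_laK).

Definition word := seq letter.

Definition letter_images (l : letter) : seq word :=
  match l with la => [:: [:: lb; la]; [:: la; lb]] | lb => [:: [:: la]] end.

Fixpoint word_images (w : word) : seq word :=
  if w is l :: w' then [seq u ++ v | u <- letter_images l, v <- word_images w']
  else [:: [::]].

Fixpoint realisations (n : nat) (w : word) : seq word :=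
  if n is n'.+1 then flatten [seq realisations n' u | u <- word_images w]
  else [:: w].

Definition legal (w : word) : Prop :=
  exists k u, u \in realisations k [:: la] /\ infix w u.

(* A finitely supported law on words is the list of its weighted outcomes;
   the same word may occur several times, its weights then add up. *)
Definition law (R : realType) := seq (R * word).

Definition letter_law (R : realType) (p : R) (l : letter) : law R :=
  match l with
  | la => [:: (p, [:: lb; la]); (1 - p, [:: la; lb])]
  | lb => [:: (1, [:: la])]
  end.

Fixpoint word_law (R : realType) (p : R) (w : word) : law R :=
  if w is l :: w' then
    [seq (x.1 * y.1, x.2 ++ y.2) | x <- letter_law p l, y <- word_law p w']
  else [:: (1, [::])].

Fixpoint iter_law (R : realType) (p : R) (n : nat) (w : word) : law R :=
  if n is n'.+1 then
    flatten [seq [seq (x.1 * y.1, y.2) | y <- iter_law p n' x.2]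
            | x <- word_law p w]
  else [:: (1, w)].

Definition law_expectation (R : realType) (d : law R) (g : word -> R) : R :=
  \sum_(x <- d) x.1 * g x.2.

Definition occurrences (w u : word) : nat :=
  count (fun i => prefix w (drop i u)) (iota 0 (size u)).

Definition frequency (R : realType) (p : R) (w : word) : R :=
  limn (fun n => law_expectation (iter_law p n [:: la])
                   (fun u => (occurrences w u)%:R)
                 / law_expectation (iter_law p n [:: la])
                   (fun u => (size u)%:R)).

Definition subword (x : int -> letter) (m : int) (n : nat) : word :=
  [seq x (m + i%:Z) | i <- iota 0 n].

Definition subshift : Type :=
  {x : int -> letter | forall m n, legal (subword x m n)}.

Definition seq_of (x : subshift) : int -> letter := sval x.
Coercion seq_of : subshift >-> Funclass.

Lemma left_shift_subproof (x : subshift) :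
  forall m n, legal (subword (fun i => x (i + 1)) m n).
Proof.
move=> m n.
have -> : subword (fun i => x (i + 1)) m n = subword x (m + 1) n.
  by apply: eq_map => i; congr (x _); rewrite addrAC.
exact: (svalP x).
Qed.

Definition left_shift (x : subshift) : subshift :=
  exist _ (fun i => x (i + 1)) (left_shift_subproof x).

Lemma word_images_cat w w' v v' :
  v \in word_images w -> v' \in word_images w' ->
  v ++ v' \in word_images (w ++ w').
Proof.
elim: w v => [|l w IH] v /=; first by rewrite inE => /eqP ->.
move=> /allpairsP [[u1 u2] /= [h1 h2 ->]] hv'.
by apply/allpairsP; exists (u1, u2 ++ v') => /=; rewrite catA IH.
Qed.

Lemma realisations_cat n w w' v v' :
  v \in realisations n w -> v' \in realisations n w' ->
  v ++ v' \in realisations n (w ++ w').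
Proof.
elim: n w w' => [|n IH] w w' /=.
  by rewrite !inE => /eqP -> /eqP ->.
move=> /flatten_mapP [u hu hv] /flatten_mapP [u' hu' hv'].
apply/flatten_mapP; exists (u ++ u'); last exact: IH.
exact: word_images_cat.
Qed.

(* A bi-infinite element of the subshift, which witnesses that it is not
   empty: the two-sided fixed point, around the seed a|a, of a |-> aba,
   b |-> ab, which is a realisation of the square of the substitution. *)
Fixpoint seed (j : nat) : word * word :=
  if j is j'.+1 then
    let: (v, u) := seed j' in (v ++ u ++ v, v ++ u)
  else ([:: la], [:: lb]).

Definition seed_seq (z : int) : letter :=
  match z with
  | Posz i => nth la (seed i).1 i
  | Negz i => nth la (rev (seed i).1) i
  end.

Lemma realisations2_la n (v : word) :
  v \in realisations n [:: la; lb; la] \/ v \in realisations n [:: lb; la; la] ->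
  v \in realisations n.+2 [:: la].
Proof.
move=> h; apply/flatten_mapP; exists [:: la; lb]; first by rewrite !inE.
case: h => h; apply/flatten_mapP.
- by exists [:: la; lb; la]; first by rewrite !inE.
- by exists [:: lb; la; la]; first by rewrite !inE.
Qed.

Lemma seedE j : seed j.+1 =
  ((seed j).1 ++ (seed j).2 ++ (seed j).1, (seed j).1 ++ (seed j).2).
Proof. by rewrite /=; case: (seed j). Qed.

Lemma seed_realisations j :
  (seed j).1 \in realisations j.*2 [:: la] /\
  (seed j).2 \in realisations j.*2 [:: lb].
Proof.
elim: j => [|j [hv hu]]; first by rewrite !inE.
rewrite doubleS seedE; split.
  apply: realisations2_la; left.
  exact: (realisations_cat hv (realisations_cat hu hv)).
apply/flatten_mapP; exists [:: la]; first by rewrite !inE.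
apply/flatten_mapP; exists [:: la; lb]; first by rewrite !inE.
exact: (realisations_cat hv hu).
Qed.

Lemma seed_legal j : legal ((seed j).1 ++ (seed j).1).
Proof.
have [hv hu] := seed_realisations j.
exists j.*2.+2, ((seed j).2 ++ (seed j).1 ++ (seed j).1); split; last first.
  exact: infix_catl (infix_refl _).
apply: realisations2_la; right.
exact: (realisations_cat hu (realisations_cat hv hv)).
Qed.

Lemma seed_size j : (j < size (seed j).1)%N.
Proof.
elim: j => // j IH; rewrite seedE !size_cat.
have := IH; case: (size (seed j).1) => // n; lia.
Qed.

Lemma seed_nth i N : (i <= N)%N ->
  nth la (seed N).1 i = nth la (seed i).1 i /\
  nth la (rev (seed N).1) i = nth la (rev (seed i).1) i.
Proof.
elim: N => [|N IH]; first by rewrite leqn0 => /eqP ->.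
rewrite leq_eqVlt => /orP [/eqP -> //|]; rewrite ltnS => iN.
have [<- <-] := IH iN.
have lt : (i < size (seed N).1)%N by apply: leq_ltn_trans (seed_size N).
rewrite seedE !rev_cat !nth_cat lt; split => //.
by rewrite size_cat !size_rev ltn_addr // lt.
Qed.

Lemma seed_seqE N (z : int) : (`|z| <= N)%N ->
  seed_seq z = nth la ((seed N).1 ++ (seed N).1) `|z + (size (seed N).1)%:Z|.
Proof.
case: z => i /= hi; have [h1 h2] := seed_nth hi; have lt := seed_size N.
  by rewrite -h1 nth_cat; case: ifP => [|_]; [lia | congr nth; lia].
have [_ <-] := seed_nth (ltnW hi).
rewrite nth_rev; last by lia.
by rewrite nth_cat; case: ifP => [_|]; [congr nth; lia | lia].
Qed.

Lemma seed_seq_legal m n : legal (subword seed_seq m n).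
Proof.
pose N := (`|m| + n)%N; pose W := (seed N).1 ++ (seed N).1.
have lt := seed_size N.
have -> : subword seed_seq m n = take n (drop `|m + (size (seed N).1)%:Z| W).
  apply: (@eq_from_nth _ la).
    by rewrite size_map size_iota size_takel // size_drop size_cat; lia.
  move=> i; rewrite size_map size_iota => lin.
  rewrite (nth_map 0%N) ?size_iota // nth_iota // add0n nth_take // nth_drop.
  rewrite (@seed_seqE N); last by lia.
  by congr nth; lia.
have [k [u [hu hW]]] := seed_legal N; exists k, u; split => //.
apply: infix_trans hW; apply: infix_trans (infix_drop _ _).
exact: infix_take.
Qed.

Definition seed_point : subshift := exist _ seed_seq seed_seq_legal.

HB.instance Definition _ := gen_eqMixin subshift.
HB.instance Definition _ := gen_choiceMixin subshift.
HB.instance Definition _ := isPointed.Build subshift seed_point.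

Definition cylinder (w : word) : set subshift :=
  [set x | subword x 0 (size w) = w].

Definition coordinate_sets : set (set subshift) :=
  [set A | exists (m : int) (l : letter), A = [set x : subshift | x m = l]].

HB.instance Definition _ :=
  Measurable.copy subshift (g_sigma_algebraType coordinate_sets).

Definition tau (R : realType) : R := (1 + Num.sqrt 5) / 2.

Definition tile_length (R : realType) (l : letter) : R :=
  if l is la then tau R else 1.

Definition left_endpoint (R : realType) (x : int -> letter) (m : int) : R :=
  match m with
  | Posz n => \sum_(i < n) tile_length R (x (Posz i))
  | Negz n => - \sum_(i < n.+1) tile_length R (x (Negz i))
  end.

(* The pair (u, l) encodes the tile [u, u + tile_length l] of type l. *)
Definition tiling_set (R : realType) := set (R * letter).

Definition tiling_of_seq (R : realType) (x : int -> letter) : tiling_set R :=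
  [set c | exists m : int, c = (left_endpoint R x m, x m)].

Definition translate_set (R : realType) (t : R) (T : tiling_set R) :
    tiling_set R :=
  [set c | T (c.1 - t, c.2)].

Definition hull (R : realType) : Type :=
  {T : tiling_set R | exists (x : subshift) (t : R),
      T = translate_set t (tiling_of_seq x)}.

Definition tiles (R : realType) (y : hull R) : tiling_set R := sval y.

Lemma translate_set0 (R : realType) (T : tiling_set R) : translate_set 0 T = T.
Proof. by rewrite /translate_set; apply/seteqP; split => -[u l] /=; rewrite subr0. Qed.

Lemma translate_setD (R : realType) (s t : R) (T : tiling_set R) :
  translate_set s (translate_set t T) = translate_set (s + t) T.
Proof.
by rewrite /translate_set; apply/seteqP; split => -[u l] /=; rewrite opprD addrA.
Qed.

Lemma translate_subproof (R : realType) (t : R) (y : hull R) :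
  exists (x : subshift) (s : R),
    translate_set t (tiles y) = translate_set s (tiling_of_seq x).
Proof.
case: y => T [x [s eT]]; exists x, (t + s).
by rewrite /tiles /= eT translate_setD.
Qed.

Definition translate (R : realType) (t : R) (y : hull R) : hull R :=
  exist _ (translate_set t (tiles y)) (translate_subproof t y).

Lemma tiling_of_subproof (R : realType) (x : subshift) :
  exists (x' : subshift) (s : R),
    tiling_of_seq x = translate_set s (tiling_of_seq x').
Proof. by exists x, 0; rewrite translate_set0. Qed.

Definition tiling_of (R : realType) (x : subshift) : hull R :=
  exist _ (tiling_of_seq x) (tiling_of_subproof R x).

HB.instance Definition _ (R : realType) := gen_eqMixin (hull R).
HB.instance Definition _ (R : realType) := gen_choiceMixin (hull R).
HB.instance Definition _ (R : realType) :=
  isPointed.Build (hull R) (tiling_of R seed_point).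

(* T and T' have the same tiles among those that meet [- r, r]. *)
Definition agree (R : realType) (r : R) (T T' : tiling_set R) : Prop :=
  forall (u : R) (l : letter), u <= r -> - r <= u + tile_length R l ->
    (T (u, l) <-> T' (u, l)).

(* The local topology: y and y' agree on [- 1/e, 1/e] after a translation by
   less than e. *)
Definition hull_close (R : realType) (e : R) (c : hull R * hull R) : Prop :=
  exists2 s : R, `|s| < e & agree e^-1 (tiles c.1) (tiles (translate s c.2)).

Definition hull_entourage (R : realType) : set_system (hull R * hull R) :=
  [set A | exists2 e : R, 0 < e & hull_close e `<=` A].

Lemma hull_close_le (R : realType) (e e' : R) : 0 < e -> e <= e' ->
  @hull_close R e `<=` hull_close e'.
Proof.
move=> e0 ee' [y z] [s hs ag]; exists s; first exact: lt_le_trans ee'.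
have iee' : e'^-1 <= e^-1 by rewrite lef_pV2 // posrE (lt_le_trans e0).
move=> u l h1 h2; apply: ag; first exact: le_trans iee'.
by apply: le_trans h2; rewrite lerN2.
Qed.

Lemma hull_entourage_filter (R : realType) : Filter (@hull_entourage R).
Proof.
split.
- by exists 1.
- move=> A B [e e0 eA] [d d0 dB]; exists (Num.min e d).
    by rewrite lt_min e0 d0.
  have m0 : 0 < Num.min e d by rewrite lt_min e0 d0.
  move=> c hc; split; [apply: eA | apply: dB].
  + by apply: hull_close_le hc => //; rewrite ge_min lexx.
  + by apply: hull_close_le hc => //; rewrite ge_min lexx orbT.
- by move=> A B AB [e e0 eA]; exists e => //; apply: subset_trans AB.
Qed.

Lemma hull_entourage_diagonal (R : realType) (A : set (hull R * hull R)) :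
  hull_entourage A -> diagonal `<=` A.
Proof.
move=> [e e0 eA] [y z] /= yz; apply: eA; exists 0; first by rewrite normr0.
have {yz} <- : y = z by exact: yz.
by move=> u l _ _; rewrite /= translate_set0.
Qed.

Lemma hull_entourage_inv (R : realType) (A : set (hull R * hull R)) :
  hull_entourage A -> hull_entourage A^-1%relation.
Proof.
move=> [e e0 eA]; pose d := e / (1 + e).
have e1 : 0 < 1 + e by lra.
have d0 : 0 < d by rewrite divr_gt0.
have d1 : d < 1 by rewrite ltr_pdivrMr //; lra.
have de : d <= e by rewrite ler_pdivrMr //; nra.
have dV : d^-1 = e^-1 + 1 by rewrite /d; field; rewrite !gt_eqF.
exists d => // -[y z] [s hs ag]; apply: eA => /=.
exists (- s); first by rewrite normrN (lt_le_trans hs).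
move=> u l /= h1 h2; move: hs; rewrite ltr_norml => /andP[s1 s2].
have /= := ag (u + s) l; rewrite /translate_set /= addrK opprK => hag.
by split=> h; apply/hag => //; rewrite dV; lra.
Qed.

Lemma hull_entourage_split (R : realType) (A : set (hull R * hull R)) :
  hull_entourage A -> exists2 B, hull_entourage B & (B \; B `<=` A)%relation.
Proof.
move=> [e e0 eA]; pose d := e / (2 + e).
have e2 : 0 < 2 + e by lra.
have d0 : 0 < d by rewrite divr_gt0.
have d1 : d < 1 by rewrite ltr_pdivrMr //; lra.
have de : d + d <= e.
  by rewrite /d -mulrDl ler_pdivrMr //; nra.
have eV : 0 < e^-1 by rewrite invr_gt0.
have dV : d^-1 = 2 * e^-1 + 1 by rewrite /d; field; rewrite !gt_eqF.
exists (@hull_close R d); first by exists d.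
move=> [y w] [z /= [s hs ag] [t ht ag']]; apply: eA => /=.
exists (s + t); first by rewrite (le_lt_trans (ler_normD _ _)) //; lra.
move=> u l h1 h2; move: hs; rewrite ltr_norml => /andP[s1 s2].
have /= a1 := ag u l; have /= a2 := ag' (u - s) l.
have b1 : u <= d^-1 by rewrite dV; lra.
have b2 : - d^-1 <= u + tile_length R l by rewrite dV; lra.
have c1 : u - s <= d^-1 by rewrite dV; lra.
have c2 : - d^-1 <= u - s + tile_length R l by rewrite dV; lra.
rewrite -translate_setD /translate_set /=.
by split=> h; [apply/(a2 c1 c2)/(a1 b1 b2) | apply/(a1 b1 b2)/(a2 c1 c2)].
Qed.

HB.instance Definition _ (R : realType) := isUniform.Build (hull R)
  (@hull_entourage_filter R) (@hull_entourage_diagonal R)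
  (@hull_entourage_inv R) (@hull_entourage_split R).

HB.instance Definition _ (R : realType) :=
  Measurable.copy (hull R) (g_sigma_algebraType (@open (hull R))).

Definition is_frequency_measure (R : realType) (p : R)
    (mu : probability subshift R) : Prop :=
  (forall A, measurable A -> mu (left_shift @^-1` A) = mu A) /\
  (forall w, legal w -> mu (cylinder w) = (frequency p w)%:E).

(* The pairs (x, t) with 0 <= t < length of the tile of x_0 parametrise the
   hull: t is the distance of the origin to the left end of the tile that
   contains it, so that (x, t) stands for the tiling of x moved by - t. *)
Definition is_suspension (R : realType) (mu : probability subshift R)
    (nu : probability (hull R) R) : Prop :=
  forall A, measurable A ->
    nu A = ((fine (\int[mu]_x (tile_length R (seq_of x 0))%:E))^-1%:E *
            \int[mu]_x lebesgue_measure
              (`[0%R, tile_length R (seq_of x 0)[ `&`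
               [set t : R | A (translate (- t) (tiling_of R x))]))%E.

Definition is_patch_frequency_measure (R : realType) (p : R)
    (nu : probability (hull R) R) : Prop :=
  exists2 mu : probability subshift R,
    is_frequency_measure p mu & is_suspension mu nu.

(* exp (2 pi i k t) *)
Definition phase (R : realType) (k t : R) : R[i] :=
  (cos (2 * pi * k * t) +i* sin (2 * pi * k * t))%C.

Definition square_integrable (R : realType) (nu : probability (hull R) R)
    (f : hull R -> R[i]) : Prop :=
  (fun y => complex.Re (f y)) \in Lfun nu 2 /\
  (fun y => complex.Im (f y)) \in Lfun nu 2.

Definition is_eigenfunction (R : realType) (nu : probability (hull R) R)
    (k : R) (f : hull R -> R[i]) : Prop :=
  [/\ square_integrable nu f,
      ~ {ae nu, forall y, f y = 0} &
      forall t, {ae nu, forall y, f (translate t y) = phase k t * f y}].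

Definition continuous_version (R : realType) (nu : probability (hull R) R)
    (k : R) (f : hull R -> R[i]) (g : hull R -> R[i]^o) : Prop :=
  [/\ continuous g,
      {ae nu, forall y, f y = g y} &
      forall t y, g (translate t y) = phase k t * g y].

Definition is_continuous_eigenfunction (R : realType)
    (nu : probability (hull R) R) (k : R) (f : hull R -> R[i]) : Prop :=
  is_eigenfunction nu k f /\ exists g, continuous_version nu k f g.

Definition topological_point_spectrum (R : realType)
    (nu : probability (hull R) R) : set R :=
  [set k | exists f, is_continuous_eigenfunction nu k f].

(* Main.v *)
Require Import Defs.
From HB Require Import structures.
From mathcomp Require Import all_boot all_order all_algebra.
From mathcomp Require Import all_classical all_reals all_analysis.
From mathcomp Require Import complex.
From mathcomp Require Import zify ring lra.

Set Implicit Arguments.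
Unset Strict Implicit.
Unset Printing Implicit Defensive.

Import Order.TTheory GRing.Theory Num.Theory.
Import numFieldNormedType.Exports.
Local Open Scope classical_set_scope.
Local Open Scope ring_scope.

(** Let [g] be a continuous eigenfunction with eigenvalue [k], and let [G x] be
    its value at the tiling of [x].  Continuity at the tiling of [x0] says that
    every [x] that carries a large central patch of [x0] around the index [m]
    satisfies [G x ~ phase k s * G x0], where [s] is the position of the tile
    [m] ([eigen_patch]).

    Any two legal words occur together in a legal word ([legal_join]), which
    extends to a point of the subshift ([legal_in_subshift]).  Hence the modulus
    of [G] is constant ([eigen_norm]), so a nonzero [g] vanishes nowhere, and
    for [k = 0] the function [g] itself is constant.

    To get [k = 0], apply this to one patch that occurs twice.  If a patch [P]
    around the origin of [x0] occurs twice in a legal word, at distance [D],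
    then [phase k D ~ 1].  It matters which [x0] is taken: for a typical
    sequence the return distances [D] of large patches are so constrained that
    no contradiction arises.  The Fibonacci fixed point is as far from typical
    as possible, and randomness gives its patches additional returns.  The two
    substitutions [fib_left : a -> ab, b -> a] and [fib_right : a -> ba, b -> a]
    satisfy [a (fib_right w) = (fib_left w) a] ([fib_conjugate]).  So if
    [Q t Q] is legal, the realisation that uses [fib_left] throughout and the
    one that switches to [fib_right] after the first [Q] both contain
    [fib_left Q] twice, at distances that differ by the length [tau] of one [a]
    ([legal_return_pair]).  One more application of [fib_left] gives the
    difference [tau + 1], the length of [ab].  The patches of the fixed point
    around the origin have both forms, however large they are
    ([seed_return_pairs]), so [phase k tau = phase k (tau + 1) = 1]
    ([phase_of_return_pair]).  Therefore [k] and [k tau] are integers, and [k]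
    is zero because [tau] is irrational ([no_common_period]). *)

(** * Legal words *)

Lemma legal_infix (w u : word) : infix w u -> legal u -> legal w.
Proof.
by move=> wu [k [U [hU uU]]]; exists k, U; split=> //; apply: infix_trans uU.
Qed.

Lemma realisationsSr (n : nat) (w u v : word) :
  u \in realisations n w -> v \in word_images u -> v \in realisations n.+1 w.
Proof.
elim: n w => [|n IH] w.
  rewrite /= inE => /eqP -> hv; apply/flatten_mapP; exists v => //.
  by rewrite inE.
move=> /flatten_mapP [w' hw' hu] hv; apply/flatten_mapP; exists w' => //.
exact: IH hu hv.
Qed.

Lemma word_images_neq0 (w : word) : exists v, v \in word_images w.
Proof.
elim: w => [|l w [v hv]]; first by exists [::].
by case: l; [exists ([:: la; lb] ++ v) | exists ([:: la] ++ v)];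
  apply/allpairsP; [exists ([:: la; lb], v) | exists ([:: la], v)].
Qed.

Lemma word_images_size (w v : word) :
  v \in word_images w -> (size w <= size v)%N.
Proof.
elim: w v => [|l w IH] v //= /allpairsP [[u1 u2] /= [h1 h2 ->]].
rewrite size_cat; have := IH _ h2; case: l h1; rewrite !inE.
  by case/orP=> /eqP -> /=; lia.
by move=> /eqP -> /=.
Qed.

Lemma realisations_inhabited (n : nat) (w : word) :
  exists2 v, v \in realisations n w & (size w <= size v)%N.
Proof.
elim: n => [|n [u hu su]]; first by exists w; rewrite //= inE.
have [v hv] := word_images_neq0 u.
exists v; first exact: realisationsSr hu hv.
exact: leq_trans su (word_images_size hv).
Qed.

Lemma legal_image (u v : word) : legal u -> v \in word_images u -> legal v.
Proof.
move=> [k [U [hU /infixP [u1 [u2 eU]]]]] hv.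
have [v1 h1] := word_images_neq0 u1; have [v2 h2] := word_images_neq0 u2.
exists k.+1, (v1 ++ v ++ v2); split; last by apply/infixP; exists v1, v2.
apply: (realisationsSr hU); rewrite eU.
by apply: word_images_cat => //; apply: word_images_cat.
Qed.

(** The image of [a] may be chosen to start with [a], so that a realisation of
    level [k] survives as a prefix at every higher level. *)
Lemma legal_at_level (w : word) : legal w ->
  exists n, forall k,
    exists2 U, U \in realisations (k + n) [:: la] & infix w U.
Proof.
move=> [n [U [hU wU]]]; exists n; elim=> [|k [V hV wV]]; first by exists U.
have [B hB _] := realisations_inhabited (k + n) [:: lb].
exists (V ++ B); last exact: infix_catr.
rewrite addSn; apply/flatten_mapP; exists [:: la; lb]; first by rewrite !inE.
exact: (realisations_cat hV hB).
Qed.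

(** Both words occur in realisations of [a] of one common level, hence in a
    realisation of [aba]; the realisation of [b] makes the gap nonempty. *)
Lemma legal_join (w1 w2 : word) : legal w1 -> legal w2 ->
  exists2 t, t != [::] & legal (w1 ++ t ++ w2).
Proof.
move=> /legal_at_level [n1 h1] /legal_at_level [n2 h2].
have [U1 hU1 /infixP [p1 [s1 e1]]] := h1 n2.
have [U2 hU2 /infixP [p2 [s2 e2]]] := h2 n1.
rewrite addnC in hU1.
have [B hB sB] := realisations_inhabited (n1 + n2) [:: lb].
exists (s1 ++ B ++ p2).
  by rewrite -size_eq0 !size_cat; move: sB => /=; lia.
exists (n1 + n2).+2, (U1 ++ B ++ U2); split.
  apply: realisations2_la; left.
  exact: (realisations_cat hU1 (realisations_cat hB hU2)).
by apply/infixP; exists p1, s2; rewrite e1 e2 -!catA.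
Qed.

Lemma legal_nil : legal [::].
Proof. by exists 0%N, [:: la]; rewrite inE. Qed.

(** Joining the word to the empty word on either side inserts a nonempty gap,
    whose nearest letter is the wanted neighbour. *)
Lemma legal_extend (w : word) : legal w ->
  exists lr : letter * letter, legal (lr.1 :: rcons w lr.2).
Proof.
move=> hw; have [t t0 ht] := legal_join legal_nil hw.
have [t' t'0 ht'] := legal_join ht legal_nil.
case/lastP: t t0 ht ht' => // t l _ _; case: t' t'0 => // r t' _ ht'.
exists (l, r); apply: legal_infix ht'; apply/infixP; exists t, t'.
by rewrite /= cats0 -!cats1 -!catA.
Qed.

(** Repeated extension by one letter on each side yields nested legal words
    that exhaust a bi-infinite sequence. *)
Lemma legal_in_subshift (w : word) : legal w -> w != [::] ->
  exists x : subshift, subword x 0 (size w) = w.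
Proof.
move=> hw w0.
have [e he] : exists e : word -> letter * letter,
    forall u, legal u -> legal ((e u).1 :: rcons u (e u).2).
  have /choice [e he] : forall u : word, exists lr : letter * letter,
      legal u -> legal (lr.1 :: rcons u lr.2).
    move=> u; have [hu|hu] := pselect (legal u); last by exists (la, la).
    by have [lr hlr] := legal_extend hu; exists lr.
  by exists e.
pose W n := iter n (fun u => (e u).1 :: rcons u (e u).2) w.
have WS n : W n.+1 = (e (W n)).1 :: rcons (W n) (e (W n)).2 by [].
have Wlegal n : legal (W n) by elim: n => // n IH; exact: he.
have Wsize n : size (W n) = (size w + n.*2)%N.
  by elim: n => [|n IH]; rewrite ?addn0 // WS /= size_rcons IH; lia.
have wpos : (0 < size w)%N by rewrite lt0n size_eq0.
have Wnth n i : (i < size (W n))%N -> nth la (W n.+1) i.+1 = nth la (W n) i.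
  by move=> hi; rewrite WS /= nth_rcons hi.
(* The index 0 of [w] sits at position [n] of [W n], so that every [W n] with
   [n] at least the absolute value of [z] gives the same letter at [z]. *)
pose x (z : int) := nth la (W (absz z)) (absz (z + Posz (absz z))).
have xE N (z : int) : (`|z| <= N)%N -> x z = nth la (W N) (absz (z + Posz N)).
  elim: N => [|N IH] hz; first by rewrite /x; move: hz; case: z => [[|?]|?].
  move: hz; rewrite leq_eqVlt => /orP [/eqP <- //|]; rewrite ltnS => hz.
  rewrite (IH hz) -Wnth; last by rewrite Wsize; lia.
  by congr nth; lia.
have xlegal m n : legal (subword x m n).
  pose N := (`|m| + n)%N.
  have -> : subword x m n = take n (drop (absz (m + Posz N)) (W N)).
    have sz := Wsize N.
    apply: (@eq_from_nth _ la).
      by rewrite size_map size_iota size_takel // size_drop sz; lia.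
    move=> i; rewrite size_map size_iota => hi.
    rewrite (nth_map 0%N) ?size_iota // nth_iota // add0n nth_take // nth_drop.
    by rewrite (@xE N); [congr nth; lia | lia].
  apply: legal_infix (Wlegal N).
  exact: infix_trans (infix_take _ _) (infix_drop _ _).
exists (exist _ x xlegal).
have Wmid n i : (i < size w)%N -> nth la (W n) (n + i)%N = nth la w i.
  move=> hi; elim: n => [//|n <-]; rewrite addSn Wnth // Wsize; lia.
apply: (@eq_from_nth _ la); first by rewrite size_map size_iota.
move=> i; rewrite size_map size_iota => hi.
rewrite (nth_map 0%N) ?size_iota // nth_iota // add0n /seq_of /= add0r.
by rewrite -(Wmid i i hi) /x; congr nth; lia.
Qed.

(** * The two deterministic Fibonacci substitutions *)

Definition fib_left : word -> word :=
  flatten \o map (fun l => if l is la then [:: la; lb] else [:: la]).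

Definition fib_right : word -> word :=
  flatten \o map (fun l => if l is la then [:: lb; la] else [:: la]).

Lemma fib_left_cat (u v : word) : fib_left (u ++ v) = fib_left u ++ fib_left v.
Proof. by rewrite /fib_left /= map_cat flatten_cat. Qed.

Lemma fib_right_cat (u v : word) :
  fib_right (u ++ v) = fib_right u ++ fib_right v.
Proof. by rewrite /fib_right /= map_cat flatten_cat. Qed.

Lemma fib_left_image (w : word) : fib_left w \in word_images w.
Proof.
elim: w => [//|l w IH]; apply/allpairsP.
by case: l; [exists ([:: la; lb], fib_left w) | exists ([:: la], fib_left w)].
Qed.

Lemma fib_right_image (w : word) : fib_right w \in word_images w.
Proof.
elim: w => [//|l w IH]; apply/allpairsP.
by case: l; [exists ([:: lb; la], fib_right w) | exists ([:: la], fib_right w)].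
Qed.

Lemma legal_fib_left (w : word) : legal w -> legal (fib_left w).
Proof. by move=> hw; apply: legal_image hw (fib_left_image w). Qed.

(** The images of a word under the two substitutions carry the same patches,
    at positions that differ by one letter [a]. *)
Lemma fib_conjugate (w : word) : la :: fib_right w = rcons (fib_left w) la.
Proof.
elim: w => // -[] w IH.
- exact: (congr1 (fun u => [:: la, lb & u]) IH).
- exact: (congr1 (cons la) IH).
Qed.

(** Substituting [fib_left] in all of [Q t Q] gives two copies of
    [fib_left Q]; switching to [fib_right] right after the first copy moves
    the second one to the left by one letter [a]. *)
Lemma legal_return_pair (Q : word) : legal Q ->
  exists t, legal (fib_left Q ++ (la :: t) ++ fib_left Q) /\
            legal (fib_left Q ++ t ++ fib_left Q).
Proof.
move=> hQ; have [[//|l u] _ hu] := legal_join hQ hQ.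
have [t et] : exists t, fib_left (l :: u) = la :: t.
  by case: l {hu}; eexists.
exists t; split; first by rewrite -et -!fib_left_cat; exact: legal_fib_left.
have e : fib_right ((l :: u) ++ Q) = t ++ rcons (fib_left Q) la.
  have := fib_conjugate ((l :: u) ++ Q).
  by rewrite fib_left_cat et rcons_cat /= => -[].
have := legal_image hu (word_images_cat (fib_left_image Q) (fib_right_image _)).
rewrite e -cats1 !catA; apply: legal_infix; exact: infix_catr (infix_refl _).
Qed.

(** The fixed point is the limit of the squares of [fib_left], so its central
    patches are images of legal words under two steps of it. *)
Lemma seed_fib j : (seed j.+1).1 = fib_left (fib_left (seed j).1).
Proof.
suff [] : (seed j.+1).1 = fib_left (fib_left (seed j).1) /\
  (seed j.+1).2 = fib_left (fib_left (seed j).2) by [].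
elim: j => [//|j [h1 h2]]; rewrite (seedE j.+1); cbn [fst snd].
have [e1 e2] : (seed j.+1).1 = (seed j).1 ++ (seed j).2 ++ (seed j).1 /\
    (seed j.+1).2 = (seed j).1 ++ (seed j).2 by rewrite seedE.
by split; [rewrite [in RHS]e1 | rewrite [in RHS]e2];
  rewrite !fib_left_cat -h1 -h2.
Qed.

(** Comparing the two substitutions at the last step shifts the second copy of
    the patch around the origin of the Fibonacci fixed point by [a]; comparing
    them one step earlier shifts it by the image [ab] of [a]. *)
Lemma seed_return_pairs j (V := (seed j.+1).1 ++ (seed j.+1).1) :
  (exists t, legal (V ++ (la :: t) ++ V) /\ legal (V ++ t ++ V)) /\
  (exists t, legal (V ++ [:: la, lb & t] ++ V) /\ legal (V ++ t ++ V)).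
Proof.
have hv := seed_legal j.
have -> : V = fib_left (fib_left ((seed j).1 ++ (seed j).1)).
  by rewrite !fib_left_cat -seed_fib.
split; first by apply: legal_return_pair; exact: legal_fib_left.
have [t [h1 h2]] := legal_return_pair hv; exists (fib_left t).
have f1 := legal_fib_left h1; have f2 := legal_fib_left h2.
by split; [move: f1 | move: f2]; rewrite !fib_left_cat.
Qed.

(** * Tile positions and the local topology *)

Lemma tile_length_ge1 (R : realType) (l : letter) : 1 <= tile_length R l.
Proof.
case: l => //=; rewrite /tau.
have : Num.sqrt (1 : R) <= Num.sqrt 5 by rewrite ler_sqrt; lra.
by rewrite sqrtr1; lra.
Qed.

Definition word_length (R : realType) (w : word) : R :=
  \sum_(l <- w) tile_length R l.

Lemma word_length_cat (R : realType) (u v : word) :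
  word_length R (u ++ v) = word_length R u + word_length R v.
Proof. exact: big_cat. Qed.

Lemma word_length_subwordS (R : realType) (x : int -> letter) (m : int)
    (n : nat) :
  word_length R (subword x m n.+1) =
  word_length R (subword x m n) + tile_length R (x (m + n%:Z)).
Proof.
rewrite /subword -addn1 iotaD map_cat word_length_cat; congr (_ + _).
by rewrite /word_length big_cons big_nil addr0 add0n.
Qed.

Lemma left_endpoint0 (R : realType) (x : int -> letter) :
  left_endpoint R x 0 = 0.
Proof. exact: big_ord0. Qed.

Lemma left_endpointS (R : realType) (x : int -> letter) (m : int) :
  left_endpoint R x (m + 1) = left_endpoint R x m + tile_length R (x m).
Proof.
case: m => [n|[|n]].
- have -> : Posz n + 1 = Posz n.+1 by lia.
  by rewrite /= big_ord_recr.
- have -> : Negz 0 + 1 = 0 by [].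
  by rewrite left_endpoint0 /= big_ord_recr big_ord0 /= add0r addNr.
- have -> : Negz n.+1 + 1 = Negz n by lia.
  by rewrite /= [in RHS]big_ord_recr /= opprD subrK.
Qed.

Lemma left_endpointD (R : realType) (x : int -> letter) (m : int) (n : nat) :
  left_endpoint R x (m + n%:Z) =
  left_endpoint R x m + word_length R (subword x m n).
Proof.
elim: n => [|n IH]; first by rewrite /word_length big_nil !addr0.
have -> : m + n.+1%:Z = m + n%:Z + 1 by lia.
by rewrite left_endpointS IH word_length_subwordS addrA.
Qed.

Lemma left_endpoint_incr (R : realType) (x : int -> letter) (i j : int) :
  i <= j -> (j - i)%:~R <= left_endpoint R x j - left_endpoint R x i.
Proof.
move=> ij; have -> : j = i + `|j - i|%N by lia.
rewrite left_endpointD.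
elim: `|j - i|%N => [|n IH].
  by rewrite /word_length big_nil !addr0 !subrr.
rewrite word_length_subwordS.
have -> : (i + n.+1%:Z - i)%:~R = (i + n%:Z - i)%:~R + 1 :> R.
  by rewrite -intrD1; congr (_%:~R); lia.
have := tile_length_ge1 R (x (i + n%:Z)); lra.
Qed.

(** Tiles have length at least 1, so the tiles meeting [-r, r] are among
    those with index between [-N] and [N]. *)
Lemma tile_index_bound (R : realType) (x : int -> letter) (m i : int)
    (N : nat) (r : R) : r < N%:R ->
  left_endpoint R x (m + i) - left_endpoint R x m <= r ->
  - r <= left_endpoint R x (m + i) - left_endpoint R x m +
         tile_length R (x (m + i)) ->
  - N%:Z <= i < N%:Z.
Proof.
move=> rN h1 h2; apply/andP; split; [rewrite leNgt | rewrite ltNge];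
  apply/negP => h.
- have /(left_endpoint_incr R x) : m + i + 1 <= m by lia.
  rewrite left_endpointS.
  have : N%:R <= (m - (m + i + 1))%:~R :> R.
    by rewrite -[N%:R]/(N%:~R) ler_int; lia.
  by lra.
- have /(left_endpoint_incr R x) : m <= m + i by lia.
  have : N%:R <= (m + i - m)%:~R :> R.
    by rewrite -[N%:R]/(N%:~R) ler_int; lia.
  by lra.
Qed.

Lemma left_endpoint_match (R : realType) (x x' : int -> letter) (m : int)
    (N : nat) : (forall i : int, - N%:Z <= i < N%:Z -> x (m + i) = x' i) ->
  forall i : int, - N%:Z <= i < N%:Z ->
    left_endpoint R x (m + i) = left_endpoint R x m + left_endpoint R x' i.
Proof.
move=> h.
have pos n : (n <= N)%N -> left_endpoint R x (m + n%:Z) =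
    left_endpoint R x m + left_endpoint R x' n%:Z.
  elim: n => [|n IH] hn; first by rewrite left_endpoint0 !addr0.
  have -> : n.+1%:Z = n%:Z + 1 by lia.
  rewrite addrA !left_endpointS IH; last by lia.
  by rewrite h ?addrA //; lia.
have neg n : (n <= N)%N -> left_endpoint R x (m - n%:Z) =
    left_endpoint R x m + left_endpoint R x' (- n%:Z).
  elim: n => [|n IH] hn; first by rewrite oppr0 left_endpoint0 !addr0.
  have := left_endpointS R x (m - n.+1%:Z).
  have := left_endpointS R x' (- n.+1%:Z).
  have -> : - n.+1%:Z + 1 = - n%:Z by lia.
  have -> : m - n.+1%:Z + 1 = m - n%:Z by lia.
  rewrite IH; last by lia.
  by rewrite (h (- n.+1%:Z)); [lra | lia].
move=> i hi; have [i0|i0] := leP 0 i.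
- have -> : i = `|i|%N by lia.
  by apply: pos; lia.
- have -> : i = - `|i|%N%:Z by lia.
  by apply: neg; lia.
Qed.

Lemma agree_at_match (R : realType) (x x' : int -> letter) (m : int)
    (N : nat) (r : R) : r < N%:R ->
  (forall i : int, - N%:Z <= i < N%:Z -> x (m + i) = x' i) ->
  agree r (tiling_of_seq x')
    (translate_set (- left_endpoint R x m) (tiling_of_seq x)).
Proof.
move=> rN h u l h1 h2; rewrite /translate_set /tiling_of_seq /= opprK.
split=> -[i [eu el]].
- have hi : - N%:Z <= i < N%:Z.
    apply: (@tile_index_bound R x' 0 i N r) => //;
    by rewrite add0r left_endpoint0 subr0 -eu -?el.
  exists (m + i); rewrite (left_endpoint_match R h hi) (h _ hi) -eu -el.
  by rewrite addrC.
- have ei : i = m + (i - m) by lia.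
  have eu' : u = left_endpoint R x (m + (i - m)) - left_endpoint R x m.
    by rewrite -ei -eu addrK.
  have hi : - N%:Z <= i - m < N%:Z.
    apply: (@tile_index_bound R x m (i - m) N r) => //;
    by rewrite -eu' // -ei -el.
  exists (i - m); rewrite -(h _ hi) -ei -el; congr pair.
  by rewrite eu' (left_endpoint_match R h hi) addrC addKr.
Qed.

(** Two tilings that agree on a large interval around the origin are close
    without any translation, so continuity bounds the change of [g] when only
    the letters near the origin are known. *)
Lemma continuous_patch (R : realType) (g : hull R -> R[i]^o) (x0 : subshift)
    (e : R[i]) : continuous g -> 0 < e ->
  exists N : nat, forall (x : subshift) (m : int),
    (forall i : int, - N%:Z <= i < N%:Z -> x (m + i) = x0 i) ->
    `|g (tiling_of R x0) -
      g (translate (- left_endpoint R x m) (tiling_of R x))| < e.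
Proof.
move=> /(_ (tiling_of R x0)) /cvgrPdist_lt cg e0.
have /nbhsP [E [d d0 dE] EP] := cg e e0.
exists (Num.trunc d^-1).+1 => x m h; apply: EP.
apply/xsectionP; apply: dE; exists 0; first by rewrite normr0.
move=> u l /= h1 h2; rewrite translate_set0.
exact: (agree_at_match (truncnS_gt d^-1) h h1 h2).
Qed.

(** * Phases *)

Lemma phaseD (R : realType) (k s t : R) :
  phase k (s + t) = phase k s * phase k t.
Proof.
rewrite /phase mulrDr cosD sinD; apply/eqP; rewrite eq_complex /=.
by rewrite eqxx /= addrC [sin _ * cos _]mulrC mulrC eqxx.
Qed.

Lemma phase0l (R : realType) (t : R) : phase 0 t = 1.
Proof. by rewrite /phase mulr0 mul0r cos0 sin0. Qed.

Lemma phase0r (R : realType) (k : R) : phase k 0 = 1.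
Proof. by rewrite /phase mulr0 cos0 sin0. Qed.

Lemma phaseNK (R : realType) (k t : R) : phase k t * phase k (- t) = 1.
Proof. by rewrite -phaseD subrr phase0r. Qed.

Lemma norm_phase (R : realType) (k t : R) : `|phase k t| = 1.
Proof. by rewrite normc_def /= cos2Dsin2 sqrtr1. Qed.

(** Reduce modulo the period to [0 <= r < 2 pi]; as the cosine is injective on
    [0, pi], either [r] or [2 pi - r] is zero. *)
Lemma cos_eq1 (R : realType) (x : R) : cos x = 1 ->
  exists n : int, x = (pi *+ 2) * n%:~R.
Proof.
have cosDn (n : nat) (y : R) : cos (y + pi *+ 2 *+ n) = cos y.
  exact: periodicn (@cosD2pi R) n y.
have cosDz (n : int) (y : R) : cos (y + (pi *+ 2) * n%:~R) = cos y.
  case: n => n; first by rewrite -[n%:~R]/(n%:R) mulr_natr cosDn.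
  by rewrite NegzE mulrNz mulrN -[n.+1%:~R]/(n.+1%:R) mulr_natr
    -(cosDn n.+1 (_ - _)) subrK.
have pi0 := pi_gt0 R.
move=> cx; pose n := Num.floor (x / (pi *+ 2)); exists n.
pose r := x - (pi *+ 2) * n%:~R.
have cr : cos r = 1 by rewrite -cx /r -mulrN -mulrNz cosDz.
have p0 : 0 < (pi : R) *+ 2 by rewrite mulrn_wgt0.
have r0 : 0 <= r.
  by rewrite subr_ge0 mulrC -ler_pdivlMr // Num.Theory.floor_le.
have r1 : r < pi *+ 2.
  rewrite ltrBlDr -[X in X + _]mulr1 -mulrDr mulrC -ltr_pdivrMr //.
  by rewrite addrC -intrD1 floorD1_gt.
suff : r = 0 by move/eqP; rewrite subr_eq0 => /eqP.
have [rpi|rpi] := leP r pi.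
  apply: (@cos_inj R); rewrite ?in_itv /= ?lexx ?r0 ?rpi ?ltW //.
  by rewrite cos0.
have e : pi *+ 2 - r = 0.
  rewrite mulr2n in r1 *.
  apply: (@cos_inj R); rewrite ?in_itv /= ?lexx ?ltW //; try lra.
  by rewrite -mulr2n cos0 addrC -(mulr1n (pi *+ 2)) (cosDn 1%N) cosN.
by rewrite mulr2n in r1 e; lra.
Qed.

Lemma phase_eq1 (R : realType) (k t : R) : phase k t = 1 ->
  exists n : int, k * t = n%:~R.
Proof.
move=> /(congr1 (@complex.Re R)) /= /cos_eq1 [n hn]; exists n.
have := pi_gt0 R => pi0.
apply: (@mulfI _ (2 * pi)); first by rewrite gt_eqF // mulr_gt0.
by rewrite mulrA hn mulr_natl.
Qed.

(** The exponent of the prime 5 would be even on the left and odd on the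
    right. *)
Lemma sqr_neq5sqr (m n : nat) : (n ^ 2 = 5 * m ^ 2)%N -> m = 0%N.
Proof.
case: m => // m e.
have n0 : (0 < n)%N by case: n e => //=; rewrite expnS; lia.
have := congr1 (logn 5) e; rewrite lognM // ?expn_gt0 // !lognX.
by rewrite (logn_prime _ (isT : prime 5)); lia.
Qed.

(** With [k = n] and [k tau = m] the equation [tau ^ 2 = tau + 1] makes
    [5 n ^ 2 = (2 m - n) ^ 2]. *)
Lemma no_common_period (R : realType) (k : R) (n m : int) :
  k = n%:~R -> k * tau R = m%:~R -> k = 0.
Proof.
move=> kn km; pose s := Num.sqrt (5 : R).
have s2 : s ^+ 2 = 5 by rewrite sqr_sqrtr.
have e : (2 * m - n)%:~R = k * s.
  by rewrite rmorphB rmorphM /= -km -kn /tau -/s; field.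
have : (((2 * m - n) ^+ 2)%:~R : R) = (5 * n ^+ 2)%:~R.
  by rewrite rmorphXn /= e rmorphM /= rmorphXn /= -kn exprMn s2 mulrC.
move/eqP; rewrite eqr_int => /eqP h.
have /sqr_neq5sqr : (absz (2 * m - n)%R ^ 2 = 5 * absz n ^ 2)%N.
  by rewrite -!abszX h abszM.
by rewrite kn => /eqP; rewrite absz_eq0 => /eqP ->.
Qed.

(** * Continuous eigenfunctions *)

(** The order need not be total, which makes this usable over [R[i]]. *)
Lemma eq_of_close (F : numFieldType) (z w : F) :
  (forall e, 0 < e -> `|z - w| < e) -> z = w.
Proof.
move=> h; apply/eqP; rewrite -subr_eq0 -normr_eq0; apply: contraT => zw.
by have := h `|z - w|; rewrite ltxx lt_def zw normr_ge0 => /(_ isT).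
Qed.

Lemma close_trans (F : numFieldType) (z w v e : F) :
  `|z - v| < e / 2 -> `|w - v| < e / 2 -> `|z - w| < e.
Proof.
move=> zv wv; rewrite (splitr e).
apply: (le_lt_trans (ler_distD v z w)).
by apply: ltrD => //; rewrite distrC.
Qed.

Lemma occurrence_nth (x : int -> letter) (u w v : word) :
  subword x 0 (size (u ++ w ++ v)) = u ++ w ++ v ->
  forall i : nat, (i < size w)%N -> x (size u + i)%N%:Z = nth la w i.
Proof.
move=> e i hi; have := congr1 (fun s => nth la s (size u + i)) e.
rewrite nth_cat ltnNge leq_addr /= addKn nth_cat hi => <-.
have hs : (size u + i < size (u ++ w ++ v))%N by rewrite !size_cat; lia.
by rewrite (nth_map 0%N) ?size_iota // nth_iota // add0r add0n.
Qed.

Lemma left_endpoint_prefix (R : realType) (x : int -> letter) (u v : word) :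
  subword x 0 (size (u ++ v)) = u ++ v ->
  left_endpoint R x (size u) = word_length R u.
Proof.
move=> e; rewrite -[Posz _]add0r left_endpointD left_endpoint0 add0r.
congr (word_length R _).
have := congr1 (take (size u)) e; rewrite take_size_cat // => {2}<-.
by rewrite /subword -map_take take_iota size_cat (minn_idPl (leq_addr _ _)).
Qed.

Definition centered_word (x : int -> letter) (N : nat) : word :=
  subword x (- N%:Z) N.*2.

Lemma centered_word_match (x y : int -> letter) (u v : word) (N : nat) :
  let W := u ++ centered_word y N ++ v in
  subword x 0 (size W) = W ->
  forall i : int, - N%:Z <= i < N%:Z -> x ((size u + N)%N%:Z + i) = y i.
Proof.
move=> /= /occurrence_nth h i hi.
have si : (absz (N%:Z + i)%R < N.*2)%N by lia.
have := h (absz (N%:Z + i)).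
rewrite /centered_word size_map size_iota => /(_ si).
rewrite (nth_map 0%N) ?size_iota // nth_iota // => e.
have -> : (size u + N)%N%:Z + i = (size u + absz (N%:Z + i)%R)%N by lia.
by rewrite e; congr y; lia.
Qed.

Lemma seed_match (x : int -> letter) (u v : word) (N j : nat) :
  (N <= j)%N -> let V := (seed j).1 in let W := u ++ (V ++ V) ++ v in
  subword x 0 (size W) = W ->
  forall i : int, - N%:Z <= i < N%:Z -> x ((size (u ++ V))%:Z + i) = seed_seq i.
Proof.
move=> Nj V W /occurrence_nth h i hi.
have lt := seed_size j; rewrite -/V in lt.
rewrite (@seed_seqE j); last by lia.
rewrite -h /=; last by rewrite size_cat -/V; lia.
by congr x; rewrite size_cat -/V; lia.
Qed.

Section Eigenfunction.

Variables (R : realType) (k : R) (g : hull R -> R[i]^o).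
Hypothesis g_cont : continuous g.
Hypothesis g_eigen : forall t y, g (translate t y) = phase k t * g y.

Let G (x : subshift) : R[i] := g (tiling_of R x).

Lemma norm_phaseM (t : R) (z : R[i]) : `|phase k t * z| = `|z|.
Proof. by rewrite normrM norm_phase mul1r. Qed.

(** If [x] carries the same patch at [m] as [x0] does at the origin, moving
    that patch to the origin gives a tiling close to that of [x0]; the
    eigenvalue equation undoes the move at the cost of a phase. *)
Lemma eigen_patch (x0 : subshift) (e : R[i]) : 0 < e ->
  exists N : nat, forall (x : subshift) (m : int),
    (forall i : int, - N%:Z <= i < N%:Z -> x (m + i) = x0 i) ->
    `|phase k (left_endpoint R x m) * G x0 - G x| < e.
Proof.
move=> e0; have [N hN] := continuous_patch x0 g_cont e0; exists N => x m h.
have := hN x m h; rewrite g_eigen -(norm_phaseM (left_endpoint R x m)).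
by rewrite mulrBr mulrA phaseNK mul1r.
Qed.

(** Some tiling contains large central patches of both [x0] and [x1]; up to
    phases, its value is close to both [G x0] and [G x1]. *)
Lemma eigen_transitive (x0 x1 : subshift) (e : R[i]) : 0 < e ->
  exists s0 s1 : R, `|phase k s0 * G x0 - phase k s1 * G x1| < e.
Proof.
move=> e0; have e20 : 0 < e / 2 by rewrite divr_gt0.
have [N0 h0] := eigen_patch x0 e20; have [N1 h1] := eigen_patch x1 e20.
have [t t0 ht] := legal_join (svalP x0 (- N0%:Z) N0.*2)
  (svalP x1 (- N1%:Z) N1.*2).
have [|x hx] := legal_in_subshift ht.
  by rewrite -size_eq0 !size_cat; case: t t0 {ht} => //= *; rewrite addnS.
pose u := centered_word x0 N0 ++ t.
exists (left_endpoint R x (0 + N0)%N), (left_endpoint R x (size u + N1)%N).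
apply: (@close_trans _ _ _ (G x)).
- apply: h0; apply: (@centered_word_match _ _ [::] (t ++ centered_word x1 N1)).
  exact: hx.
- apply: h1; apply: (@centered_word_match _ _ u [::]).
  by move: hx; rewrite cats0 /u -catA; exact.
Qed.

Lemma eigen_norm (x0 x1 : subshift) : `|G x0| = `|G x1|.
Proof.
apply: eq_of_close => e e0; have [s0 [s1 h]] := eigen_transitive x0 x1 e0.
apply: le_lt_trans h; rewrite -(norm_phaseM s0 (G x0)) -(norm_phaseM s1 (G x1)).
exact: ler_dist_dist.
Qed.

(** In a tiling with two copies of the patch [V V] of the fixed point, the
    centres of the copies are [V t V] apart, and moving either one to the origin
    gives a tiling close to that of the fixed point. *)
Lemma eigen_seed_return (e : R[i]) : 0 < e ->
  exists N : nat, forall (j : nat) (t : word), (N <= j)%N ->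
    let V := (seed j).1 in legal ((V ++ V) ++ t ++ V ++ V) ->
    `|phase k (word_length R (V ++ t ++ V)) * G seed_point - G seed_point| < e.
Proof.
move=> e0; have e20 : 0 < e / 2 by rewrite divr_gt0.
have [N hN] := eigen_patch seed_point e20; exists N => j t Nj V ht.
have [|x hx] := legal_in_subshift ht.
  by rewrite -size_eq0 !size_cat -/V; case: (size V) (seed_size j : (j < size V)%N).
pose u := (V ++ V) ++ t.
have /hN h1 := @seed_match x [::] (t ++ V ++ V) N j Nj hx.
have /hN h2 : forall i : int, - N%:Z <= i < N%:Z ->
    x ((size (u ++ V))%:Z + i) = seed_seq i.
  by apply: (@seed_match x u [::] N j Nj); rewrite cats0 /u -catA; exact: hx.
have := close_trans h2 h1.
rewrite (@left_endpoint_prefix _ _ V (V ++ t ++ V ++ V)); last first.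
  by rewrite catA; exact: hx.
rewrite (@left_endpoint_prefix _ _ (u ++ V) V); last first.
  by rewrite /u -!catA; rewrite -!catA in hx; exact: hx.
have -> : u ++ V = V ++ V ++ t ++ V by rewrite /u -!catA.
by rewrite word_length_cat phaseD -mulrA -mulrBr norm_phaseM.
Qed.

(** Two close return times of the same patch that differ by the length of [c]
    make the phase of that length close to 1 on [G seed_point]. *)
Lemma phase_of_return_pair (c : word) : G seed_point != 0 ->
  (forall j, let P := (seed j.+1).1 ++ (seed j.+1).1 in
     exists t, legal (P ++ (c ++ t) ++ P) /\ legal (P ++ t ++ P)) ->
  phase k (word_length R c) = 1.
Proof.
move=> G0 h; apply: (mulIf G0); rewrite mul1r; apply: eq_of_close => e e0.
have e20 : 0 < e / 2 by rewrite divr_gt0.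
have [N hN] := eigen_seed_return e20.
have [t [/hN h1 /hN h2]] := h N.
have {}h1 := h1 (leqnSn N); have {}h2 := h2 (leqnSn N).
set V := (seed N.+1).1 in h1 h2.
rewrite -(norm_phaseM (word_length R (V ++ t ++ V))) mulrBr mulrA -phaseD.
rewrite (_ : _ + _ = word_length R (V ++ (c ++ t) ++ V)).
  exact: close_trans h1 h2.
by rewrite !word_length_cat; ring.
Qed.

Lemma eigenvalue_eq0 : G seed_point != 0 -> k = 0.
Proof.
move=> G0.
have pa : phase k (tau R) = 1.
  have <- : word_length R [:: la] = tau R by rewrite /word_length big_seq1.
  by apply: phase_of_return_pair => // j P; have [] := seed_return_pairs j.
have pab : phase k (1 + tau R) = 1.
  have <- : word_length R [:: la; lb] = 1 + tau R.
    by rewrite /word_length !big_cons big_nil addr0 addrC.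
  by apply: phase_of_return_pair => // j P; have [] := seed_return_pairs j.
have p1 : phase k 1 = 1 by move: pab; rewrite phaseD pa mulr1.
have [n hn] := phase_eq1 p1; have [m hm] := phase_eq1 pa.
by apply: (@no_common_period R k n m) => //; rewrite -hn mulr1.
Qed.

Lemma eigen_trivial (y0 : hull R) : g y0 != 0 ->
  k = 0 /\ exists2 c : R[i], c != 0 & g = cst c.
Proof.
have hullE y : exists (x : subshift) (t : R), g y = phase k t * G x.
  case: (y) => T [x [t eT]]; exists x, t; rewrite -g_eigen; congr g.
  exact: eq_exist.
have [x0 [t0 ->]] := hullE y0 => g0.
have G0 : G seed_point != 0.
  rewrite -normr_eq0 (eigen_norm _ x0) normr_eq0.
  by apply: contraNneq g0 => ->; rewrite mulr0.
have k0 := eigenvalue_eq0 G0; split=> //.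
exists (G seed_point) => //; apply/funext => y.
have [x [t ->]] := hullE y; rewrite k0 phase0l mul1r.
apply: eq_of_close => e e0.
have [s0 [s1]] := eigen_transitive x seed_point e0.
by rewrite k0 !phase0l !mul1r.
Qed.

End Eigenfunction.

Theorem proposition7p4 (R : realType) (p : R) (hp : 0 < p < 1)
    (nu : probability (hull R) R) (hnu : is_patch_frequency_measure p nu) :
  [/\ topological_point_spectrum nu = [set 0],
      forall c : R[i], c != 0 -> is_continuous_eigenfunction nu 0 (cst c) &
      forall (k : R) (f : hull R -> R[i]) (g : hull R -> R[i]^o),
        is_eigenfunction nu k f -> continuous_version nu k f g ->
        k = 0 /\ exists2 c : R[i], c != 0 & g = cst c].
Proof.
have trivial (k : R) (f : hull R -> R[i]) (g : hull R -> R[i]^o) :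
    is_eigenfunction nu k f -> continuous_version nu k f g ->
    k = 0 /\ exists2 c : R[i], c != 0 & g = cst c.
  move=> [_ f0 _] [g_cont fg g_eigen].
  have [y0 g0] : exists y, g y != 0.
    apply: contrapT => /forallNP g0; apply: f0; apply: filterS fg => y ->.
    by apply/eqP; apply: contrapT => /negP /g0.
  exact: (@eigen_trivial R k g g_cont g_eigen y0 g0).
have constants (c : R[i]) : c != 0 -> is_continuous_eigenfunction nu 0 (cst c).
  move=> c0; split.
    split.
    - by split; exact: Lfun_cst.
    - have PF : ProperFilter (almost_everywhere nu).
        have nu_gt0 : (0 < nu setT)%E by rewrite probability_setT lte01.
        exact: ae_properfilter_algebraOfSetsType nu_gt0.
      by move=> /filter_ex [y /= /eqP]; apply/negP.
    - by move=> t; apply: aeW => y; rewrite phase0l mul1r.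
  exists (cst c : hull R -> R[i]^o); split.
  - exact: cst_continuous.
  - exact: aeW.
  - by move=> t y; rewrite phase0l mul1r.
split=> //; apply/seteqP; split=> [k [f [ef [g eg]]]|k /= ->].
  by have [] := trivial k f g ef eg.
by exists (cst 1); apply: constants; exact: oner_neq0.
Qed.
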